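(* Let $p\ge q\ge 1$ be integers. Let $Q_{p,q}\subseteq\mathbb{R}^{\mathcal{I}_{p,q}}$ be the polytope defined by the nonnegativity constraints $x\ge 0$, the row-sum inequalities $x(\mathrm{row}_i)\le 1$ for all $i\in[p]$, and all shifted-column inequalities. Let $$P_{p,q}=\{(x,y)\in\mathbb{R}^{\mathcal{I}_{p,q}}\times\mathbb{R}^{A_{p,q}} : y\in F_{p,q},\ (x,y)\text{ satisfies (a) and (b)}\},$$ where (a) is $y_{(i-1,j-1)^{\searrow}}\le x_{ij}$ for all $(i,j)\in\mathcal{I}_{p,q}$, and (b) is $x(\mathrm{bar}_{i,j})\le y(\mathrm{in}^{\searrow}(\mathrm{col}_{i,j}))$ for all $(i,j)\in\mathcal{I}_{p,q}$. Then for each $x\in Q_{p,q}$ there is some $y\in F_{p,q}$ with $(x,y)\in P_{p,q}$.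
   Context: Notation: $[n]=\{1,\dots,n\}$, $[n]_0=\{0,1,\dots,n\}$, $q(i)=\min\{i,q\}$, $\mathcal{I}_{p,q}=\{(i,j)\in[p]\times[q] : i\ge j\}$, $\mathrm{row}_i=\{(i,j)\in\mathcal{I}_{p,q} : j\in[q]\}$. For a vector $z\in\mathbb{R}^M$ and $N\subseteq M$, $z(N)=\sum_{e\in N}z_e$. The directed acyclic graph $D_{p,q}=(V_{p,q},A_{p,q})$ has node set $V_{p,q}=\mathcal{I}_{p,q}\uplus([p]_0\times\{0\})\uplus\{s\}\uplus\{t\}$ and the following arcs: - vertical arcs $(i,j)^{\downarrow}=((i,j),(i+1,j))$ for $i\in[p-1]_0$, $j\in[q(i)]_0$; - diagonal arcs $(i,j)^{\searrow}=((i,j),(i+1,j+1))$ for $i\in[p-1]_0$, $j\in[q(i+1)-1]_0$; - the arc $(s,(0,0))$; - the arcs $((p,j),t)$ for $j\in[q]_0$. $F_{p,q}\subseteq\mathbb{R}^{A_{p,q}}$ is the set of all $s$-$t$-flows in $D_{p,q}$ of flow value one without capacity restrictions: $y\ge 0$, flow conservation at every node other than $s,t$, and one unit of flow leaving $s$. For $W\subseteq V_{p,q}$, $\mathrm{in}^{\searrow}(W)$ is the set of diagonal arcs $(u,w)$ with $w\in W$, $u\notin W$. For $(i,j)\in\mathcal{I}_{p,q}$: $\mathrm{bar}_{i,j}=\{(i,\ell)\in\mathcal{I}_{p,q} : \ell\ge j\}$ and $\mathrm{col}_{i,j}=\{(k,j) : j\le k\le i\}$. Shifted-column inequalities: for a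 directed path $\Gamma$ in $D_{p,q}$ (possibly of length zero), $S(\Gamma)$ is the set of nodes on $\Gamma$ that are not entered by $\Gamma$ via diagonal arcs (so the start node of $\Gamma$ always belongs to $S(\Gamma)$). A subset $S\subseteq\mathcal{I}_{p,q}$ is a shifted column if $S=S(\Gamma)$ for some directed path $\Gamma$ in $D_{p,q}$ from $(\ell,\ell)$ to $(i-1,j-1)$ with $i\in[p]\setminus\{1\}$, $j\in[q]\setminus\{1\}$, $\ell\in[q]$. The associated shifted-column inequality is $x(\mathrm{bar}_{i,j})\le x(S)$. *)

(* Defs.v *)
From HB Require Import structures.
From mathcomp Require Import all_boot all_order all_algebra.

Set Implicit Arguments.
Unset Strict Implicit.
Unset Printing Implicit Defensive.

Import Order.TTheory GRing.Theory Num.Theory.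

Local Open Scope nat_scope.

(* Indices are kept 1-based: [p]_0 and [q]_0 are the types 'I_p.+1 and
   'I_q.+1, and the lower bound 1 is imposed by the predicate. *)
Definition in_I p q (e : 'I_p.+1 * 'I_q.+1) : bool :=
  [&& 1 <= e.1, 1 <= e.2 & e.2 <= e.1].

(* I_{p,q} *)
Definition cell p q := {e : 'I_p.+1 * 'I_q.+1 | in_I e}.

(* I_{p,q} together with column 0 *)
Definition in_grid p q (e : 'I_p.+1 * 'I_q.+1) : bool :=
  in_I e || (e.2 == 0 :> nat).

Definition grid p q := {e : 'I_p.+1 * 'I_q.+1 | in_grid e}.

Definition crow p q (c : cell p q) : nat := (val c).1.
Definition ccol p q (c : cell p q) : nat := (val c).2.
Definition grow p q (g : grid p q) : nat := (val g).1.
Definition gcol p q (g : grid p q) : nat := (val g).2.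

(* V_{p,q} *)
Inductive node p q := Src | Snk | Pt of grid p q.
Arguments Src {p q}.
Arguments Snk {p q}.

Definition node_code p q (v : node p q) : option (option (grid p q)) :=
  match v with Src => None | Snk => Some None | Pt g => Some (Some g) end.

Definition node_decode p q (o : option (option (grid p q))) : node p q :=
  match o with None => Src | Some None => Snk | Some (Some g) => Pt g end.

Lemma node_codeK p q : cancel (@node_code p q) (@node_decode p q).
Proof. by case. Qed.

HB.instance Definition _ p q :=
  Finite.copy (node p q) (can_type (@node_codeK p q)).

Definition is_pt p q (i j : nat) (v : node p q) : bool :=
  if v is Pt g then (grow g == i) && (gcol g == j) else false.

Lemma cell_in_grid p q (c : cell p q) : in_grid (val c).
Proof. by rewrite /in_grid (valP c). Qed.

Definition cell_node p q (c : cell p q) : node p q :=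
  Pt (Sub (val c) (cell_in_grid c)).

(* The ranges of i and j in the definitions of vertical and diagonal arcs say
   exactly that both endpoints are nodes, which the type already enforces. *)
Definition vertical p q (u v : node p q) : bool :=
  match u, v with
  | Pt a, Pt b => (grow b == (grow a).+1) && (gcol b == gcol a)
  | _, _ => false
  end.

Definition diagonal p q (u v : node p q) : bool :=
  match u, v with
  | Pt a, Pt b => (grow b == (grow a).+1) && (gcol b == (gcol a).+1)
  | _, _ => false
  end.

Definition is_arc p q (u v : node p q) : bool :=
  [|| vertical u v, diagonal u v,
      (u == Src) && is_pt 0 0 v |
      (v == Snk) && [exists j : 'I_q.+1, is_pt p j u]].

(* A_{p,q}; D_{p,q} has no parallel arcs *)
Definition darc p q := {a : node p q * node p q | is_arc a.1 a.2}.

Definition arc_tail p q (a : darc p q) : node p q := (val a).1.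
Definition arc_head p q (a : darc p q) : node p q := (val a).2.

(* The diagonal arc from (i-1,j-1) entering (i,j) in I_{p,q}. *)
Lemma pred_ord_subproof n (k : 'I_n.+1) : k.-1 < n.+1.
Proof. exact: leq_ltn_trans (leq_pred k) (ltn_ord k). Qed.

Definition nw_coord p q (c : cell p q) : 'I_p.+1 * 'I_q.+1 :=
  (Ordinal (pred_ord_subproof (val c).1), Ordinal (pred_ord_subproof (val c).2)).

Lemma nw_in_grid p q (c : cell p q) : in_grid (nw_coord c).
Proof.
have /and3P[] := valP c; rewrite /in_grid /in_I /=.
by case: (val c).1 (val c).2 => [[|[|i]] hi] [[|[|j]] hj] //= _ _ ji; rewrite orbF.
Qed.

Definition nw_node p q (c : cell p q) : node p q :=
  Pt (Sub (nw_coord c) (nw_in_grid c)).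

Lemma nw_is_arc p q (c : cell p q) : is_arc (nw_node c) (cell_node c).
Proof.
have /and3P[i1 j1 _] := valP c.
by rewrite /is_arc /= /grow /gcol /= !prednK ?eqxx ?orbT.
Qed.

Definition diag_into p q (c : cell p q) : darc p q :=
  Sub (nw_node c, cell_node c) (nw_is_arc c).

Definition in_diag p q (W : {set node p q}) : {set darc p q} :=
  [set a | [&& diagonal (arc_tail a) (arc_head a),
               arc_head a \in W & arc_tail a \notin W]].

Definition row_set p q (i : nat) : {set cell p q} := [set c | crow c == i].

Definition bar_set p q (i j : nat) : {set cell p q} :=
  [set c | (crow c == i) && (j <= ccol c)].

Definition col_set p q (i j : nat) : {set cell p q} :=
  [set c | (ccol c == j) && (j <= crow c <= i)].

(* A directed path is given by its start node u and the sequence w of its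
   further nodes; its arcs are the consecutive pairs zip (u :: w) w. *)
Definition path_S p q (u : node p q) (w : seq (node p q)) : {set node p q} :=
  [set v in u :: w |
    ~~ has (fun a => (a.2 == v) && diagonal a.1 a.2) (zip (u :: w) w)].

(* The pair (i,j) is recorded because S alone does not determine it: extending
   a path by a diagonal arc does not change path_S.  That S lies in I_{p,q} is
   the last conjunct. *)
Definition shifted_column p q (i j : nat) (S : {set cell p q}) : Prop :=
  [/\ 2 <= i <= p, 2 <= j <= q &
      exists (l : nat) (u : node p q) (w : seq (node p q)),
        [/\ 1 <= l <= q, is_pt l l u, path (@is_arc p q) u w,
            is_pt i.-1 j.-1 (last u w) &
            [set cell_node c | c in S] = path_S u w]].

Local Open Scope ring_scope.

(* z(N) *)
Definition vsum (R : realFieldType) (M : finType) (z : {ffun M -> R})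
  (N : {set M}) : R := \sum_(e in N) z e.

Definition in_Q (R : realFieldType) p q (x : {ffun cell p q -> R}) : Prop :=
  [/\ forall c, 0 <= x c,
      forall i : nat, (1 <= i <= p)%N -> vsum x (row_set p q i) <= 1 &
      forall (i j : nat) (S : {set cell p q}),
        shifted_column i j S -> vsum x (bar_set p q i j) <= vsum x S].

Definition in_F (R : realFieldType) p q (y : {ffun darc p q -> R}) : Prop :=
  [/\ forall a, 0 <= y a,
      forall v : node p q, v != Src -> v != Snk ->
        vsum y [set a | arc_head a == v] = vsum y [set a | arc_tail a == v] &
      vsum y [set a | arc_tail a == Src] = 1].

Definition in_P (R : realFieldType) p q (x : {ffun cell p q -> R})
    (y : {ffun darc p q -> R}) : Prop :=
  [/\ in_F y,
      forall c : cell p q, y (diag_into c) <= x c &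
      forall c : cell p q,
        vsum x (bar_set p q (crow c) (ccol c)) <=
        vsum y (in_diag [set cell_node d | d in col_set p q (crow c) (ccol c)])].

(* Main.v *)
Require Import Defs.
From HB Require Import structures.
From mathcomp Require Import all_boot all_order all_algebra.

Set Implicit Arguments.
Unset Strict Implicit.
Unset Printing Implicit Defensive.

Import Order.TTheory GRing.Theory Num.Theory.

Local Open Scope ring_scope.

(* A unit flow is determined by the total amounts Y i j entering the columns
   >= j no later than in row i, and the pointwise largest admissible choice is
   Y i j = min (Y (i-1) j + x_ij) (Y (i-1) (j-1)), with Y i 0 = 1 and
   Y 0 j = 0 for j > 0.  Unrolling the minimum, Y i j is at least 1 or equals
   x(S(Gamma)) for some path Gamma from (l,l) to (i,j); so x(bar_{i,j}) <= Y i j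
   follows from the row-sum and the shifted-column inequalities. *)

(** * Nodes and cells by their coordinates, and [path_S] along a growing path *)

Section Grid.
Variables p q : nat.

Lemma gridP (g : grid p q) : [/\ grow g <= p, gcol g <= q & gcol g <= grow g]%N.
Proof.
split; [by rewrite -ltnS ltn_ord | by rewrite -ltnS ltn_ord |].
by have /orP[/and3P[]|/eqP] := valP g; rewrite /gcol /grow // => ->.
Qed.

Lemma grid_at i j : (i <= p)%N -> (j <= q)%N -> (j <= i)%N ->
  exists g : grid p q, grow g = i /\ gcol g = j.
Proof.
move=> ip jq ji.
pose e : 'I_p.+1 * 'I_q.+1 :=
  (Ordinal (ip : (i < p.+1)%N), Ordinal (jq : (j < q.+1)%N)).
have he : in_grid e.
  by rewrite /in_grid /in_I /= ji andbT; case: j jq ji {e} => [|j] // _; case: i ip.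
by exists (Sub e he).
Qed.

Lemma grid_inj (g h : grid p q) : grow g = grow h -> gcol g = gcol h -> g = h.
Proof.
move=> hr hc; apply/val_inj/eqP.
by rewrite -pair_eqE; apply/andP; split; apply/eqP/val_inj.
Qed.

Lemma cellP (c : cell p q) :
  [/\ 1 <= ccol c, ccol c <= crow c, crow c <= p & ccol c <= q]%N.
Proof.
by have /and3P[_ j1 ji] := valP c; split; rewrite // -ltnS ltn_ord.
Qed.

Lemma cell_at i j : (1 <= j)%N -> (j <= i)%N -> (i <= p)%N -> (j <= q)%N ->
  exists c : cell p q, crow c = i /\ ccol c = j.
Proof.
move=> j1 ji ip jq.
pose e : 'I_p.+1 * 'I_q.+1 :=
  (Ordinal (ip : (i < p.+1)%N), Ordinal (jq : (j < q.+1)%N)).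
have he : in_I e by rewrite /in_I /= j1 ji (leq_trans j1 ji).
by exists (Sub e he).
Qed.

Lemma cell_node_inj : injective (@cell_node p q).
Proof. by move=> c d [h]; apply: val_inj. Qed.

(** Since [v] is new, no earlier arc enters it, so the last arc alone decides whether [v] counts;
    that arc enters no other node, so the old nodes keep their status. *)
Lemma path_S_rcons (u v : node p q) w : v \notin u :: w ->
  path_S u (rcons w v) =
    if diagonal (last u w) v then path_S u w else v |: path_S u w.
Proof.
move=> vw.
have zipE : zip (u :: rcons w v) (rcons w v) = rcons (zip (u :: w) w) (last u w, v).
  by elim: w u {vw} => //= a w IH u; rewrite IH.
have noentry : has (fun a => (a.2 == v) && diagonal a.1 a.2) (zip (u :: w) w) = false.
  apply/hasP => -[[a b] ab /= /andP[/eqP bv _]].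
  have: b \in unzip2 (zip (u :: w) w) by apply/mapP; exists (a, b).
  by rewrite unzip2_zip //= bv => bw; rewrite inE bw orbT in vw.
apply/setP => z; rewrite !inE zipE has_rcons /= mem_rcons inE.
have [->|zv] := eqVneq z v.
  rewrite /= noentry orbF orbT /=.
  by case: ifP => dg; rewrite !inE ?eqxx // -in_cons (negPf vw).
by case: ifP => _; rewrite !inE ?(negPf zv).
Qed.

(** * Sums over nodes and over the arcs at a node *)

Section Sums.
Variable R : realFieldType.

Lemma sum_node (F : node p q -> R) : \sum_u F u = F Src + F Snk + \sum_g F (Pt g).
Proof.
rewrite (bigD1 Src) //= (bigD1 Snk) //= addrA; congr (_ + _).
rewrite (reindex_omap (@Pt p q) (fun v => if v is Pt g then Some g else None)).
  by apply: eq_bigl => g; rewrite /= eqxx.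
by case.
Qed.

(** Coordinates determine a node, so the sum has at most one term; the test on the right says
    whether that node exists. *)
Lemma sum_grid_at i j (P : pred (grid p q)) (F : grid p q -> R) z :
    (forall g, P g = (grow g == i) && (gcol g == j)) ->
    (forall g, P g -> F g = z) ->
  \sum_(g | P g) F g = if [&& i <= p, j <= q & j <= i]%N then z else 0.
Proof.
move=> PE FE; case: ifP => [/and3P[ip jq ji]|out].
  have [g [gi gj]] := grid_at ip jq ji.
  rewrite (big_pred1 g) ?FE ?PE ?gi ?gj ?eqxx // => h; rewrite PE /=.
  apply/andP/eqP => [[/eqP hi /eqP hj]|->]; last by rewrite gi gj.
  by apply: grid_inj; rewrite ?gi ?gj.
rewrite big_pred0 // => g; rewrite PE; apply/negbTE/negP => /andP[/eqP gi /eqP gj].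
by have [] := gridP g; rewrite gi gj => a b c; rewrite a b c in out.
Qed.

(** Replaces sums over the subtype of arcs by sums over all nodes, so that conservation can be
    checked by cases on the neighbour. *)
Lemma sum_darc_head (f : node p q -> node p q -> R) v :
    (forall u w, ~~ is_arc u w -> f u w = 0) ->
  \sum_(a in [set a : darc p q | arc_head a == v]) f (arc_tail a) (arc_head a) =
  \sum_u f u v.
Proof.
move=> f0; rewrite [RHS](bigID (fun u => is_arc u v)) /=.
rewrite [X in _ + X]big1 ?addr0; last first.
  by move=> u; apply: f0.
rewrite [RHS](reindex_omap (@arc_tail p q)
  (fun u => insub (u, v) : option (darc p q))); last by move=> u uv; rewrite insubT.
apply: eq_big => [[[u w] uw]|[[u w] uw]]; rewrite inE /arc_head /arc_tail /=.
  2: by move=> /eqP wv; subst w.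
apply/eqP/andP => [wv|[uv]].
  by subst w; split=> //; rewrite insubT //; apply/eqP; congr Some; apply: val_inj.
by rewrite insubT => /eqP[].
Qed.

Lemma sum_darc_tail (f : node p q -> node p q -> R) v :
    (forall u w, ~~ is_arc u w -> f u w = 0) ->
  \sum_(a in [set a : darc p q | arc_tail a == v]) f (arc_tail a) (arc_head a) =
  \sum_w f v w.
Proof.
move=> f0; rewrite [RHS](bigID (fun w => is_arc v w)) /=.
rewrite [X in _ + X]big1 ?addr0; last first.
  by move=> u; apply: f0.
rewrite [RHS](reindex_omap (@arc_head p q)
  (fun w => insub (v, w) : option (darc p q))); last by move=> u uv; rewrite insubT.
apply: eq_big => [[[u w] uw]|[[u w] uw]]; rewrite inE /arc_tail /arc_head /=.
  2: by move=> /eqP uv; subst u.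
apply/eqP/andP => [wv|[uv]].
  by subst u; split=> //; rewrite insubT //; apply/eqP; congr Some; apply: val_inj.
by rewrite insubT => /eqP[].
Qed.

End Sums.
End Grid.

(** * The greedy recursion and its monotonicity *)

Section Greedy.
Variables (R : realFieldType) (X : nat -> nat -> R).

(* [X i j] bounds the flow on the diagonal arc entering (i,j). *)
Fixpoint inflow (i j : nat) : R :=
  match j, i with
  | 0%N, _ => 1
  | _.+1, 0%N => 0
  | j'.+1, i'.+1 => Num.min (inflow i' j + X i j) (inflow i' j')
  end.

Lemma inflow0 i : inflow i 0 = 1. Proof. by case: i. Qed.

Hypothesis X_ge0 : forall i j, 0 <= X i j.

Lemma inflow_ge0 i j : 0 <= inflow i j.
Proof.
elim: i j => [|i IH] [|j] //=; rewrite ?ler01 // le_min IH andbT.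
by rewrite addr_ge0.
Qed.

Lemma inflow_diag i j : inflow i.+1 j.+1 <= inflow i j.
Proof. by rewrite /= ge_min lexx orbT. Qed.

Lemma inflow_step i j : inflow i.+1 j.+1 - inflow i j.+1 <= X i.+1 j.+1.
Proof. by rewrite lerBlDl [leLHS]/= ge_min lexx. Qed.

(** Both arguments of the minimum dominate the entry above: the first because [X] is nonnegative,
    the second by a diagonal step followed by the induction hypothesis one column to the left. *)
Lemma inflow_mono i j : inflow i j <= inflow i.+1 j.
Proof.
elim: i j => [|i IH] [|j]; rewrite ?inflow0 //; first exact: inflow_ge0.
rewrite [leRHS]/= le_min lerDl X_ge0 /=.
exact: le_trans (inflow_diag i j) (IH j).
Qed.

Lemma inflow_upper i j : (i < j)%N -> inflow i j = 0.
Proof.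
elim: i j => [|i IH] [|j] //; rewrite ltnS => ij /=.
by rewrite (IH j.+1) ?(IH j) ?add0r ?min_r // (leq_trans ij).
Qed.

(** Meant for column [q.+1], where it says that no flow passes beyond column [q]. *)
Lemma inflow_col_eq0 j : (forall i, X i j.+1 = 0) -> forall i, inflow i j.+1 = 0.
Proof.
by move=> X0; elim=> //= i ->; rewrite X0 add0r min_l ?inflow_ge0.
Qed.

End Greedy.

(** * Unrolling the recursion into shifted columns, and the bounds on bars *)

Section Columns.
Variables (R : realFieldType) (p q : nat) (x : {ffun cell p q -> R}).

(** The extension of [x] by zero to all pairs of naturals, written as a sum with at most one term so
    that the recursion needs no membership proofs. *)
Definition entry i j : R := \sum_(c | (crow c == i) && (ccol c == j)) x c.

Lemma entry_cell c : entry (crow c) (ccol c) = x c.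
Proof. by rewrite /entry (big_pred1 c). Qed.

Lemma entry_out i j : (q < j)%N -> entry i j = 0.
Proof.
move=> qj; rewrite /entry big_pred0 // => c; apply/negbTE/negP => /andP[_ /eqP cj].
by have [_ _ _] := cellP c; rewrite cj leqNgt qj.
Qed.

Hypothesis x_ge0 : forall c, 0 <= x c.

Lemma entry_ge0 i j : 0 <= entry i j.
Proof. exact: sumr_ge0. Qed.

Local Notation Y := (inflow entry).

Definition above i (v : node p q) : bool :=
  if v is Pt g then (grow g <= i)%N else false.

Lemma is_pt_cell i j (c : cell p q) :
  is_pt i j (cell_node c) = (crow c == i) && (ccol c == j).
Proof. by []. Qed.

Lemma above_cell i (c : cell p q) : above i (cell_node c) = (crow c <= i)%N.
Proof. by []. Qed.

Lemma vertical_cell i j u (c : cell p q) : is_pt i j u ->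
  vertical u (cell_node c) = (crow c == i.+1) && (ccol c == j).
Proof. by case: u => //= g /andP[/eqP -> /eqP ->]. Qed.

Lemma diagonal_cell i j u (c : cell p q) : is_pt i j u ->
  diagonal u (cell_node c) = (crow c == i.+1) && (ccol c == j.+1).
Proof. by case: u => //= g /andP[/eqP -> /eqP ->]. Qed.

(* The [above] conjunct ensures that each extension of the path adds a new node. *)
Definition column_le i j (z : R) : Prop :=
  exists (l : nat) (u : node p q) (w : seq (node p q)) (S : {set cell p q}),
    [/\ (1 <= l <= q)%N /\ is_pt l l u, path (@is_arc p q) u w /\ is_pt i j (last u w),
        all (above i) (u :: w),
        [set cell_node c | c in S] = path_S u w & vsum x S <= z].

Lemma column_le_start (c : cell p q) : crow c = ccol c ->
  column_le (crow c) (ccol c) (x c).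
Proof.
move=> diag_c; have [j1 _ _ jq] := cellP c.
exists (ccol c), (cell_node c), [::], [set c].
split; rewrite ?is_pt_cell ?diag_c ?eqxx ?j1 //.
- by rewrite all_seq1 above_cell diag_c leqnn.
- by rewrite imset_set1; apply/setP => v; rewrite !inE andbT.
- by rewrite /vsum big_set1.
Qed.

Lemma above_rcons i u w (c : cell p q) : all (above i) (u :: w) -> crow c = i.+1 ->
  cell_node c \notin u :: w /\ all (above i.+1) (u :: rcons w (cell_node c)).
Proof.
move=> ab ci; split; first by apply/negP => /(allP ab); rewrite above_cell ci ltnn.
rewrite -rcons_cons all_rcons above_cell ci leqnn /=.
by apply: sub_all ab => -[||g] //=; apply: leqW.
Qed.

(** A node entered diagonally does not join the shifted column, so [S] and the bound stay the
    same. *)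
Lemma column_le_diagonal i j z (c : cell p q) :
    column_le i j z -> crow c = i.+1 -> ccol c = j.+1 ->
  column_le i.+1 j.+1 z.
Proof.
move=> [l [u [w [S [hl [hp hlast] ab hS hz]]]]] ci cj.
have dg : diagonal (last u w) (cell_node c).
  by rewrite (diagonal_cell _ hlast) ci cj !eqxx.
have [new ab'] := above_rcons ab ci.
exists l, u, (rcons w (cell_node c)), S; split=> //.
- by rewrite last_rcons rcons_path hp is_pt_cell ci cj !eqxx /is_arc dg orbT.
- by rewrite path_S_rcons // dg.
Qed.

(** A node entered vertically joins the shifted column and adds exactly [x c], because [S] so far
    lies in rows up to [i]. *)
Lemma column_le_vertical i j z (c : cell p q) :
    column_le i j z -> crow c = i.+1 -> ccol c = j ->
  column_le i.+1 j (z + x c).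
Proof.
move=> [l [u [w [S [hl [hp hlast] ab hS hz]]]]] ci cj.
have vt : vertical (last u w) (cell_node c).
  by rewrite (vertical_cell _ hlast) ci cj !eqxx.
have dg : diagonal (last u w) (cell_node c) = false.
  by rewrite (diagonal_cell _ hlast) cj (ltn_eqF (ltnSn j)) andbF.
have [new ab'] := above_rcons ab ci.
have newS : c \notin S.
  apply: contra new => cS; have := imset_f (@cell_node p q) cS.
  by rewrite hS !inE => /andP[].
exists l, u, (rcons w (cell_node c)), (c |: S); split=> //.
- by rewrite last_rcons rcons_path hp is_pt_cell ci cj !eqxx /is_arc vt.
- by rewrite path_S_rcons // dg imsetU1 hS.
- by rewrite /vsum big_setU1 //= addrC lerD2r.
Qed.

(** Induction on the row: a minimum attained by its first argument extends the path vertically, by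
    its second diagonally. The alternative [1 <= Y i j] arises when the unrolling reaches column
    0. *)
Lemma inflow_column i j : (1 <= j <= i)%N -> (i <= p)%N -> (j <= q)%N ->
  1 <= Y i j \/ column_le i j (Y i j).
Proof.
elim: i j => [|i IH] [|j] // /andP[_ ji] ip jq.
have [c [ci cj]] := cell_at (isT : (1 <= j.+1)%N) ji ip jq.
have xc : entry i.+1 j.+1 = x c by rewrite -ci -cj entry_cell.
rewrite [Y i.+1 j.+1]/= xc; case: (leP (Y i j.+1 + x c) (Y i j)) => _.
  (* If [c] lies on the main diagonal, there is no cell above it and [Y] vanishes there, so the path
     starts at [c]. *)
  have [ij|] := ltnP j i; last first.
    move=> ij; have {ij}ij : j = i by apply/eqP; rewrite eqn_leq ij andbT.
    rewrite inflow_upper ?add0r ?ij //; last exact: entry_ge0.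
    by right; have := @column_le_start c; rewrite ci cj ij; apply.
  have [Y1|col] := IH j.+1 ij (ltnW ip) jq; [left|right].
    by rewrite (le_trans Y1) // lerDl.
  exact: column_le_vertical col _ _.
case: j => [|j] in ji jq cj xc *; first by left; rewrite inflow0.
have [?|col] := IH j.+1 ji (ltnW ip) (ltnW jq); [by left|right].
exact: column_le_diagonal col ci cj.
Qed.

Lemma vsum_sub (A B : {set cell p q}) : A \subset B -> vsum x A <= vsum x B.
Proof.
move=> AB; rewrite /vsum [leRHS](big_setID A) /= (setIidPr AB) lerDl.
exact: sumr_ge0.
Qed.

Lemma bar_split (c : cell p q) :
  vsum x (bar_set p q (crow c) (ccol c)) =
  vsum x (bar_set p q (crow c) (ccol c).+1) + x c.
Proof.
rewrite addrC /vsum -big_setU1 ?inE ?ltnn ?andbF //=; apply: eq_bigl => d.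
rewrite !inE [(ccol c <= _)%N]leq_eqVlt andb_orr [ccol c == _]eq_sym.
by congr (_ || _).
Qed.

Hypothesis row_le1 : forall i, (1 <= i <= p)%N -> vsum x (row_set p q i) <= 1.
Hypothesis shifted_le : forall (i j : nat) (S : {set cell p q}),
  shifted_column i j S -> vsum x (bar_set p q i j) <= vsum x S.

Lemma bar_le1 i j : (1 <= i <= p)%N -> vsum x (bar_set p q i j) <= 1.
Proof.
move=> /row_le1; apply/le_trans/vsum_sub/subsetP => c.
by rewrite !inE => /andP[].
Qed.

(** The constraints of Q enter here: a row sum if [Y i j] is at least 1, otherwise the
    shifted-column inequality for the path ending at the northwest neighbour of the first position
    of the bar. *)
Lemma bar_le_inflow_nw i j : (i < p)%N -> vsum x (bar_set p q i.+1 j.+1) <= Y i j.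
Proof.
move=> ip; case: j => [|j]; first by rewrite inflow0 bar_le1.
(* Outside this range the bar is empty. *)
have [/andP[ji jq]|out] := boolP ((j < i) && (j.+1 < q))%N; last first.
  rewrite /vsum big_pred0 ?inflow_ge0 //; first exact: entry_ge0.
  move=> c; rewrite inE; apply/negbTE/negP => /andP[/eqP ci jc].
  have [_ cc _ cq] := cellP c.
  by rewrite (leq_trans jc cq) -ltnS -ci (leq_trans jc cc) in out.
have [Y1|] := inflow_column (ji : 1 <= j.+1 <= i)%N (ltnW ip) (ltnW jq).
  by apply: le_trans Y1; apply: bar_le1.
case=> l [u [w [S [[hl pu] [hp hlast] _ hS hz]]]].
apply: le_trans hz; apply: shifted_le; split.
- by rewrite ip !ltnS (leq_trans _ ji).
- by rewrite jq.
by exists l, u, w; split.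
Qed.

(** The previous bound is applied to both arguments of the minimum: directly for the diagonal one,
    and to the bar without [c] for the vertical one, [x c] being added on both sides. *)
Lemma bar_le_inflow (c : cell p q) :
  vsum x (bar_set p q (crow c) (ccol c)) <= Y (crow c) (ccol c).
Proof.
have [j1 ji ip jq] := cellP c.
have xc := entry_cell c; have barc := bar_split c; move: xc barc ip.
case: (crow c) (ccol c) j1 ji {jq} => [|i] [|j] // _ _ xc barc ip.
rewrite [leRHS]/= le_min bar_le_inflow_nw // andbT barc xc lerD2r.
exact: bar_le_inflow_nw.
Qed.

End Columns.

(** * The flow with prescribed cumulative inflows [Y] *)

Section Flow.
Variables (R : realFieldType) (p q : nat) (Y : nat -> nat -> R).

(** The throughput of node (i,j) is to be [Y i j - Y i j.+1]. The diagonal arc carries the growth of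
    [Y] in column [j.+1] from row [i] to row [i.+1], the vertical arc the remainder; at most one of
    the two summands is active. *)
Definition flow (u v : node p q) : R :=
  match u, v with
  | Src, Pt _ => if is_pt 0 0 v then 1 else 0
  | Pt a, Snk => if grow a == p then Y p (gcol a) - Y p (gcol a).+1 else 0
  | Pt a, Pt _ =>
      (if vertical u v
       then Y (grow a) (gcol a) - Y (grow a).+1 (gcol a).+1 else 0) +
      (if diagonal u v
       then Y (grow a).+1 (gcol a).+1 - Y (grow a) (gcol a).+1 else 0)
  | _, _ => 0
  end.

Lemma flow_non_arc u v : ~~ is_arc u v -> flow u v = 0.
Proof.
rewrite /is_arc; case: u v => [||a] [||b] //=.
- by case: ifP; rewrite ?orbT.
- have [ap|//] := eqVneq; case/negP.
  have [_ aq _] := gridP a.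
  apply/existsP; exists (Ordinal (aq : (gcol a < q.+1)%N)).
  by rewrite /= eqxx.
- by case: ifP => //=; case: ifP => //= _ _ _; rewrite addr0.
Qed.

Hypothesis Y_col0 : forall i, Y i 0 = 1.
Hypothesis Y_upper : forall i j, (i < j)%N -> Y i j = 0.
Hypothesis Y_out : forall i, Y i q.+1 = 0.
Hypothesis Y_diag : forall i j, Y i.+1 j.+1 <= Y i j.
Hypothesis Y_mono : forall i j, Y i j <= Y i.+1 j.

Lemma flow_ge0 u v : 0 <= flow u v.
Proof.
case: u v => [||a] [||b] //=; first by case: ifP; rewrite ?ler01.
  case: ifP => // _; rewrite subr_ge0.
  (* The comparison passes through row [p.+1], outside the grid, where [Y] is still defined. *)
  exact: le_trans (Y_mono _ _) (Y_diag _ _).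
by rewrite addr_ge0 //; case: ifP => // _; rewrite subr_ge0.
Qed.

(** The vertical and diagonal contributions telescope to the throughput; for missing arcs the
    formula has to give the right value by the boundary conditions on [Y]. *)
Lemma flow_in (b : grid p q) :
  \sum_u flow u (Pt b) = Y (grow b) (gcol b) - Y (grow b) (gcol b).+1.
Proof.
rewrite sum_node /= addr0 big_split /= -!big_mkcond /=.
have [] := gridP b; case: (grow b) (gcol b) => [|i] j ip jq ji.
  move: ji; rewrite leqn0 => /eqP ->.
  by rewrite !big_pred0 ?addr0 ?Y_col0 ?(Y_upper (ltn0Sn 0)) ?subr0.
rewrite add0r (@sum_grid_at _ _ _ i j _ _ (Y i j - Y i.+1 j.+1)); last first.
- by move=> g /andP[/eqP[<-] /eqP ->].
- by move=> g; rewrite eqSS ![_ == i]eq_sym ![_ == j]eq_sym.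
(* On the main diagonal no vertical arc enters, but both terms of the difference are then zero. *)
have -> : (if [&& i <= p, j <= q & j <= i]%N then Y i j - Y i.+1 j.+1 else 0) =
    Y i j - Y i.+1 j.+1.
  rewrite (ltnW ip) jq /=; case: leqP => // ij.
  by rewrite !Y_upper ?subr0 // ltnS.
case: j => [|j] in jq ji *.
  by rewrite big_pred0 ?addr0 ?Y_col0 // => g; rewrite andbF.
rewrite (@sum_grid_at _ _ _ i j _ _ (Y i.+1 j.+1 - Y i j.+1)); last first.
- by move=> g /andP[/eqP[<-] /eqP[<-]].
- by move=> g; rewrite !eqSS ![_ == i]eq_sym ![_ == j]eq_sym.
by rewrite (ltnW ip) (ltnW jq) -ltnS ji addrC addrA subrK.
Qed.

Lemma flow_out (a : grid p q) :
  \sum_v flow (Pt a) v = Y (grow a) (gcol a) - Y (grow a) (gcol a).+1.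
Proof.
rewrite sum_node /= add0r big_split /= -!big_mkcond /=.
have [] := gridP a; move: (grow a) (gcol a) => i j ip jq ji.
rewrite (@sum_grid_at _ _ _ i.+1 j _ _ (Y i j - Y i.+1 j.+1)) //.
rewrite (@sum_grid_at _ _ _ i.+1 j.+1 _ _ (Y i.+1 j.+1 - Y i j.+1)) //.
rewrite jq (leqW ji) !ltnS ji !andbT; have [->|ne] := eqVneq i p.
  by rewrite ltnn !addr0.
have {}ip : (i < p)%N by rewrite ltn_neqAle ne.
rewrite ip add0r; case: ltnP => [_|qj]; first by rewrite addrA subrK.
(* In column [q] no diagonal arc leaves; [Y] is zero in column [q.+1], so the vertical arc carries
   everything. *)
by have -> : j = q by [apply/eqP; rewrite eqn_leq jq]; rewrite !Y_out addr0.
Qed.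

Lemma flow_src : \sum_v flow Src v = 1.
Proof.
rewrite sum_node /= !add0r -big_mkcond /=.
by rewrite (@sum_grid_at _ _ _ 0 0 _ _ 1).
Qed.

Definition flow_ffun : {ffun darc p q -> R} :=
  [ffun a => flow (arc_tail a) (arc_head a)].

Lemma in_F_flow : in_F flow_ffun.
Proof.
split=> [a|v vs vt|]; first by rewrite ffunE flow_ge0.
  rewrite /vsum; under eq_bigr do rewrite ffunE.
  under [RHS]eq_bigr do rewrite ffunE.
  rewrite (sum_darc_head v flow_non_arc) (sum_darc_tail v flow_non_arc).
  by case: v vs vt => // g _ _; rewrite flow_in flow_out.
rewrite /vsum; under eq_bigr do rewrite ffunE.
by rewrite (sum_darc_tail Src flow_non_arc) flow_src.
Qed.

Lemma flow_diag_into (c : cell p q) :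
  flow_ffun (diag_into c) = Y (crow c) (ccol c) - Y (crow c).-1 (ccol c).
Proof.
have [j1 ji _ _] := cellP c.
rewrite ffunE /= /grow /gcol /= -/(crow c) -/(ccol c).
rewrite !prednK ?(leq_trans j1 ji) // !eqxx /= -[X in X == _](prednK j1).
by rewrite (gtn_eqF (ltnSn _)) add0r.
Qed.

(** Each diagonal arc carries a row increment of [Y], so the sum telescopes down the column from the
    value 0 above the main diagonal. *)
Lemma sum_col i j : (1 <= j <= q)%N -> (i <= p)%N ->
  \sum_(d in col_set p q i j) flow_ffun (diag_into d) = Y i j.
Proof.
move=> /andP[j1 jq]; elim: i => [|i IH] ip.
  rewrite Y_upper // big_pred0 // => d; rewrite inE leqn0.
  have [d1 dd _ _] := cellP d.
  by rewrite (gtn_eqF (leq_trans d1 dd)) !andbF.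
have [ij|ji] := ltnP i.+1 j.
  rewrite Y_upper // big_pred0 // => d; rewrite inE; apply/negbTE/negP.
  by case/and3P=> _ jd /(leq_trans jd); rewrite leqNgt ij.
have [c [ci cj]] := cell_at j1 ji ip jq.
have -> : col_set p q i.+1 j = c |: col_set p q i j.
  apply/setP => d; rewrite !inE; have -> : (d == c) = (crow d == i.+1) && (ccol d == j)
    by rewrite -ci -cj.
  rewrite [(crow d <= i.+1)%N]leq_eqVlt ltnS !andb_orr; congr (_ || _).
  by have [->|_] := eqVneq (crow d) i.+1; rewrite ?ji ?andbF ?andbT.
rewrite big_setU1 ?IH ?(ltnW ip) //=; last by rewrite inE ci ltnn !andbF.
by rewrite flow_diag_into ci cj subrK.
Qed.

(** The arcs [diag_into d], for [d] in the column, are distinct members of the cut with total flow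
    [Y]; any further arcs carry nonnegative flow. *)
Lemma in_diag_col (c : cell p q) :
  Y (crow c) (ccol c) <=
  vsum flow_ffun (in_diag [set cell_node d | d in col_set p q (crow c) (ccol c)]).
Proof.
have inj : injective (@diag_into p q).
  by move=> d e /(congr1 (@arc_head p q)) /cell_node_inj.
have [c1 _ cp cq] := cellP c.
rewrite -sum_col ?c1 // /vsum -(big_imset _ (in2W inj)) /=.
set A := _ @: _; set B := in_diag _.
rewrite [leRHS](big_setID A) /= (setIidPr _) ?lerDl.
  by apply: sumr_ge0 => a _; rewrite ffunE flow_ge0.
apply/subsetP => a /imsetP[d dcol ->]; rewrite inE; apply/and3P; split.
- have [j1 ji _ _] := cellP d.
  rewrite /diagonal /= /grow /gcol /= -/(crow d) -/(ccol d).
  by rewrite !prednK ?(leq_trans j1 ji) // !eqxx.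
- exact: imset_f.
(* The tail lies one column to the left, hence outside the column set. *)
apply/imsetP => -[e ecol /= [/(congr1 (fun o => val (snd o))) /= E]].
move: dcol ecol; rewrite !inE => /andP[/eqP dc _] /andP[/eqP ec _].
have [j1 _ _ _] := cellP d.
move: E; rewrite -/(ccol d) -/(ccol e) ec -dc => E.
by move: (ltn_predL (ccol d)); rewrite E ltnn j1.
Qed.

End Flow.

(** * The greedy flow for a point of Q *)

Theorem theorem12 (R : realFieldType) (p q : nat)
    (hq : (1 <= q)%N) (hqp : (q <= p)%N) (x : {ffun cell p q -> R}) :
  in_Q x -> exists2 y : {ffun darc p q -> R}, in_F y & in_P x y.
Proof.
move=> [x0 xrow xcol]; pose Y := inflow (entry x).
have e0 := entry_ge0 x0.
have Yout : forall i, Y i q.+1 = 0.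
  by apply: inflow_col_eq0 => // i; apply: entry_out.
have Yup i j : (i < j)%N -> Y i j = 0 by apply: inflow_upper.
have Ydiag i j : Y i.+1 j.+1 <= Y i j by apply: inflow_diag.
have Ymono i j : Y i j <= Y i.+1 j by apply: inflow_mono.
have yF : in_F (flow_ffun p q Y) by apply: in_F_flow => // i; apply: inflow0.
exists (flow_ffun p q Y) => //; split=> // c.
  (* Constraint (a): the arc carries a row increment of [Y], which the recursion caps by the entry
     of [x]. *)
  rewrite flow_diag_into -(entry_cell x c); have [j1 ji _ _] := cellP c.
  case: (crow c) (ccol c) j1 ji => [|i] [|j] //= _ _.
  exact: inflow_step.
(* Constraint (b), with [Y] at the position of [c] as the intermediate value. *)
apply: le_trans (bar_le_inflow x0 xrow xcol c) _.
exact: in_diag_col.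
Qed.
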